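(* Every direct system $((S_\lambda,W_\lambda)_{\lambda\in\Omega},(\phi_{\mu,\lambda})_{\mu\ge\lambda})$ in the category $\mathrm{SCu}$ has a (direct) limit in $\mathrm{SCu}$.
   Context: Positively ordered monoids are commutative monoids with a compatible partial order for which $0$ is the least element. In a partially ordered set where increasing sequences have suprema, $x\ll y$ means: for every increasing sequence $(z_n)$ with $y\le\sup_n z_n$ there is $m$ with $x\le z_m$. A $\mathrm{Cu}$-semigroup is a positively ordered monoid $S$ satisfying: (O1) increasing sequences have suprema; (O2) every element is the supremum of a sequence $(x_n)$ with $x_n\ll x_{n+1}$ for all $n$; (O3) $x'\ll x$, $y'\ll y$ imply $x'+y'\ll x+y$; (O4) $\sup_n(x_n+y_n)=\sup_n x_n+\sup_n y_n$ for increasing sequences. $\mathrm{Cu}$-morphisms are the monoid maps preserving order, $\ll$ and suprema of increasing sequences. A sequence $(x_n)$ in $S$ is weakly increasing if there is an increasing sequence $(y_m)$ in $S$ such that for every $m$ there is $n(m)$ with $y_m\le x_n$ for all $n\ge n(m)$, and $x_n\le \sup_m y_m$ for every $n$ (then $\sup_n x_n=\sup_m y_m$ exists). The category $\mathrm{SCu}$ has as objects pairs $(S,W)$ with $S$ a $\mathrm{Cu}$-semigroup and $W$ a submonoid of $S$ such that the supremum of any sequence in $W$ that is weakly increasing in $S$ belongs to $W$; morphisms $(S_1,W_1)\to(S_2,W_2)$ are $\mathrm{Cu}$-morphisms $f\colon S_1\to S_2$ with $f(W_1)\subseteq W_2$. A direct system is indexed by a directed set $\Omega$, with $\phi_{\lambda,\lambda}=\mathrm{id}$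 and $\phi_{\mu,\lambda}\circ\phi_{\lambda,\nu}=\phi_{\mu,\nu}$ for $\nu\le\lambda\le\mu$. *)

(* Defs.v *)
From HB Require Import structures.
From mathcomp Require Import all_boot all_order.
From mathcomp Require Import boolp classical_sets.

Set Implicit Arguments.
Unset Strict Implicit.
Unset Printing Implicit Defensive.

Import Order.TTheory.

Local Open Scope classical_set_scope.
Local Open Scope order_scope.

Reserved Notation "x ≪ y" (at level 70, no associativity).

(* "Increasing" is meant in the non-strict sense. *)
Definition increasing d (P : porderType d) (u : nat -> P) : Prop :=
  {homo u : m n / (m <= n)%N >-> m <= n}.

Definition is_seq_sup d (P : porderType d) (u : nat -> P) (s : P) : Prop :=
  isLub (range u) s.

Definition way_below d (P : porderType d) (x y : P) : Prop :=
  forall (z : nat -> P) (s : P), increasing z -> is_seq_sup z s ->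
    y <= s -> exists m, x <= z m.

Notation "x ≪ y" := (way_below x y).

Fact pom_display : Order.disp_t. Proof. exact: Order.Disp tt tt. Qed.

(* The additive nmodType is not reused here: the hierarchy's only join of
   additive and ordered structures is POrderedZmodule, which requires
   opposites, and no weaker join can be declared after it. *)
HB.mixin Record isPositivelyOrderedMonoid M
    of Order.POrder pom_display M := {
  pom_zero : M;
  pom_add : M -> M -> M;
  pom_addA : associative pom_add;
  pom_addC : commutative pom_add;
  pom_add0 : left_id pom_zero pom_add;
  pom_ge0 : forall x : M, pom_zero <= x;
  pom_leD2r : forall z x y : M, x <= y -> pom_add x z <= pom_add y z
}.

#[short(type="pomType")]
HB.structure Definition POM :=
  { M of Order.POrder pom_display M & isPositivelyOrderedMonoid M }.

HB.instance Definition _ (M : pomType) :=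
  Monoid.isComLaw.Build M pom_zero pom_add pom_addA pom_addC pom_add0.

Declare Scope pom_scope.
Delimit Scope pom_scope with pom.
Notation "0" := pom_zero : pom_scope.
Notation "x + y" := (pom_add x y) : pom_scope.
Local Open Scope pom_scope.

HB.mixin Record isCuSemigroup S of POM S := {
  cuO1 : forall u : nat -> S, increasing u -> exists s, is_seq_sup u s;
  cuO2 : forall x : S, exists u : nat -> S,
    (forall n, u n ≪ u n.+1) /\ is_seq_sup u x;
  cuO3 : forall x' x y' y : S, x' ≪ x -> y' ≪ y -> x' + y' ≪ x + y;
  cuO4 : forall (u v : nat -> S) (s t : S), increasing u -> increasing v ->
    is_seq_sup u s -> is_seq_sup v t ->
    is_seq_sup (fun n => u n + v n) (s + t)
}.

#[short(type="cuType")]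
HB.structure Definition Cu := { S of POM S & isCuSemigroup S }.

Record cu_morphism (S T : cuType) (f : S -> T) : Prop := CuMorphism {
  cu_mor0 : f 0 = 0;
  cu_morD : forall x y, f (x + y) = f x + f y;
  cu_mor_le : forall x y, x <= y -> f x <= f y;
  cu_mor_way_below : forall x y, x ≪ y -> f x ≪ f y;
  cu_mor_sup : forall (u : nat -> S) (s : S), increasing u ->
    is_seq_sup u s -> is_seq_sup (fun n => f (u n)) (f s)
}.

Definition weakly_increasing (S : cuType) (x : nat -> S) : Prop :=
  exists y : nat -> S, [/\ increasing y,
    forall m, exists n0, forall n, (n0 <= n)%N -> y m <= x n &
    forall s, is_seq_sup y s -> forall n, x n <= s].

Record scuType := SCu {
  scu_cu :> cuType;
  scu_sub : set scu_cu;
  scu_sub0 : scu_sub 0;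
  scu_subD : forall x y, scu_sub x -> scu_sub y -> scu_sub (x + y);
  scu_sub_sup : forall (x : nat -> scu_cu) (s : scu_cu),
    (forall n, scu_sub (x n)) -> weakly_increasing x -> is_seq_sup x s ->
    scu_sub s
}.

Record scuHom (S T : scuType) := SCuHom {
  scu_fun :> S -> T;
  scu_fun_cu : cu_morphism scu_fun;
  scu_fun_sub : forall x, scu_sub x -> scu_sub (scu_fun x)
}.

Definition directed d (I : preorderType d) : Prop :=
  (exists i : I, True) /\
  forall i j : I, exists k : I, i <= k /\ j <= k.

(* sys_map h, for h : l <= m, is the map written \phi_{m,l}. *)
Record scuSystem d (I : preorderType d) := SCuSystem {
  sys_obj :> I -> scuType;
  sys_map : forall l m : I, l <= m -> scuHom (sys_obj l) (sys_obj m);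
  sys_map_id : forall (l : I) (ll : l <= l), sys_map ll =1 id;
  sys_map_comp : forall (n l m : I)
    (nl : n <= l) (lm : l <= m) (nm : n <= m),
    sys_map lm \o sys_map nl =1 sys_map nm
}.

Record scuCocone d (I : preorderType d) (D : scuSystem I) := SCuCocone {
  cocone_obj :> scuType;
  cocone_leg : forall l : I, scuHom (D l) cocone_obj;
  cocone_comm : forall (l m : I) (lm : l <= m),
    cocone_leg m \o sys_map D lm =1 cocone_leg l
}.

Definition is_direct_limit d (I : preorderType d) (D : scuSystem I)
    (L : scuCocone D) : Prop :=
  forall C : scuCocone D, exists2 f : scuHom L C,
    forall l, f \o cocone_leg L l =1 cocone_leg C l &
    forall g : scuHom L C,
      (forall l, g \o cocone_leg L l =1 cocone_leg C l) -> g =1 f.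

(* Main.v *)
Require Import Defs.
From HB Require Import structures.
From mathcomp Require Import all_boot all_order.
From mathcomp Require Import boolp classical_sets.

(** The limit of the Cu-semigroups is built in two steps.

    The algebraic limit of the system is represented by the pairs [(l, x)] with
    [x] in the [l]-th object; on such pairs the only relation that matters is
    [(l, x) ≺ (m, y)], meaning that the images of [x] and [y] in all sufficiently
    late objects satisfy [≪]. Every pair is approximated from below by a countable
    [≺]-increasing chain, [≺] is compatible with addition, and whatever lies
    [≺]-below a sum lies below a sum of smaller terms ([prec_sup], [prec_chain],
    [precD], [prec_split]); all this descends from (O2)-(O4) in the objects, because
    the connecting maps preserve [≪] and suprema.

    Such a monoid lacks suprema of increasing sequences, and they are adjoined by
    passing to the countably generated round ideals, ordered by inclusion:
    suprema become unions, and [I ≪ J] means that a single element of [J] bounds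
    [I] ([ideal_way_belowP]). This is a Cu-semigroup, and it is the
    universal one: a map to a Cu-semigroup that respects [≺] and its
    approximations extends uniquely, by sending an ideal to the supremum
    of the image of a generating chain ([extend_cu], [extend_unique]). The legs of a
    cocone glue to such a map, which gives the universal property.

    The distinguished submonoid of the limit is the smallest one
    that contains the images of the given submonoids and is closed under suprema
    of weakly increasing sequences. Cu-morphisms preserve weakly increasing
    sequences together with their suprema, so the preimage of an admissible
    submonoid is admissible ([scu_closed_preimage]); minimality then says that the
    map induced by a cocone respects the submonoids. *)

Set Implicit Arguments.
Unset Strict Implicit.
Unset Printing Implicit Defensive.

Import Order.TTheory.

Local Open Scope classical_set_scope.
Local Open Scope order_scope.
Local Open Scope pom_scope.

(** * Suprema and the way-below relation *)

Section Suprema.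
Context d (P : porderType d).
Implicit Types (u : nat -> P) (s x y : P).

Lemma seq_supP u s :
  is_seq_sup u s <->
  (forall n, u n <= s) /\ (forall t, (forall n, u n <= t) -> s <= t).
Proof.
split=> [[ub lst]|[ub lst]]; split.
- by move=> n; apply: ub; exists n.
- by move=> t ut; apply: lst => _ [n _ <-].
- by move=> _ [n _ <-].
- by move=> t ut; apply: lst => n; apply: ut; exists n.
Qed.

Lemma isLub_unique (A : set P) s t : isLub A s -> isLub A t -> s = t.
Proof.
by move=> [ubs ls] [ubt lt]; apply/le_anti; rewrite ls//= lt.
Qed.

Lemma increasing_step u : (forall n, u n <= u n.+1) -> increasing u.
Proof. by move=> u_step; apply: homo_leq => //; exact: le_trans. Qed.

Lemma increasing_const x : increasing (fun=> x).
Proof. by []. Qed.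

Lemma seq_sup_const x : is_seq_sup (fun=> x) x.
Proof. by apply/seq_supP; split=> // t; apply; exact: 0%N. Qed.

Lemma way_below_le x y : x ≪ y -> x <= y.
Proof. by move=> /(_ _ _ (@increasing_const y) (seq_sup_const y) (lexx y))[]. Qed.

Lemma le_way_below_trans x y z : x <= y -> y ≪ z -> x ≪ z.
Proof.
move=> xy yz w s winc ws /(yz _ _ winc ws)[m ym].
by exists m; exact: le_trans ym.
Qed.

Lemma way_below_le_trans x y z : x ≪ y -> y <= z -> x ≪ z.
Proof. by move=> xy yz w s winc ws zs; apply: xy ws (le_trans yz zs). Qed.

Lemma way_below_trans x y z : x ≪ y -> y ≪ z -> x ≪ z.
Proof. by move=> /way_below_le; exact: le_way_below_trans. Qed.

End Suprema.

Section CuLemmas.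
Context (S : cuType).
Implicit Types x y z : S.

Lemma pom_leD x x' y y' : x <= x' -> y <= y' -> x + y <= x' + y' :> S.
Proof.
move=> xx' yy'; apply: (@le_trans _ _ (x' + y)); first exact: pom_leD2r.
by rewrite ![x' + _]pom_addC; exact: pom_leD2r.
Qed.

Lemma way_below0 x : 0 ≪ x.
Proof. by move=> z s _ _ _; exists 0%N; exact: pom_ge0. Qed.

(** (O2) together with the consequences of it that are always used along. *)
Lemma way_below_chain x : exists u : nat -> S,
  [/\ forall n, u n ≪ u n.+1, increasing u, forall n, u n ≪ x & is_seq_sup u x].
Proof.
have [u [u_step ux]] := cuO2 x; exists u.
split=> //; first by apply: increasing_step => n; exact: way_below_le.
move=> n; apply: way_below_le_trans (u_step n) _.
by have /seq_supP[] := ux.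
Qed.

Lemma way_below_interpolate x z : x ≪ z -> exists2 y, x ≪ y & y ≪ z.
Proof.
have [u [u_step uinc uz usup]] := way_below_chain z.
move=> /(_ _ _ uinc usup (lexx z))[m xum].
by exists (u m.+1) => //; exact: le_way_below_trans (u_step m).
Qed.

End CuLemmas.

(** * Monoids with an auxiliary relation *)

(** An abstraction of the algebraic direct limit: only the relation that becomes [≪]
    is recorded, and the monoid laws are required only as far as this relation
    can see them, so that no quotient has to be formed. Up to this, these are the
    W-semigroups whose completions are the Cu-semigroups. *)
Record wmonoid := WMonoid {
  wm_sort :> Type;
  wm_prec : wm_sort -> wm_sort -> Prop;
  wm_zero : wm_sort;
  wm_add : wm_sort -> wm_sort -> wm_sort;
  wm_trans : forall a b c, wm_prec a b -> wm_prec b c -> wm_prec a c;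
  wm_prec0 : forall a, wm_prec wm_zero a;
  wm_chain : forall a, exists u : nat -> wm_sort,
    [/\ forall n, wm_prec (u n) (u n.+1), forall n, wm_prec (u n) a &
        forall b, wm_prec b a -> exists n, wm_prec b (u n)];
  wm_precD : forall a a' b b', wm_prec a a' -> wm_prec b b' ->
    wm_prec (wm_add a b) (wm_add a' b');
  wm_split : forall p a b, wm_prec p (wm_add a b) ->
    exists a' b', [/\ wm_prec a' a, wm_prec b' b & wm_prec p (wm_add a' b')];
  wm_addC : forall p a b, wm_prec p (wm_add a b) -> wm_prec p (wm_add b a);
  wm_addA : forall p a b c,
    wm_prec p (wm_add a (wm_add b c)) <-> wm_prec p (wm_add (wm_add a b) c);
  wm_add0 : forall p a, wm_prec p (wm_add wm_zero a) <-> wm_prec p a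
}.

Notation "a ≺ b" := (wm_prec a b) (at level 70, no associativity).

(** * The completion by countably generated round ideals *)

(** The generators need not form a chain: in this form countable generation passes
    to countable unions at once, and [ideal_chain] recovers a chain. *)
Record is_ideal (M : wmonoid) (I : M -> Prop) : Prop := IsIdeal {
  ideal0 : I (wm_zero M);
  ideal_down : forall a b, a ≺ b -> I b -> I a;
  ideal_dir : forall a b, I a -> I b -> exists c, [/\ I c, a ≺ c & b ≺ c];
  ideal_gen : exists g : nat -> M,
    (forall n, I (g n)) /\ (forall a, I a -> exists n, a ≺ g n)
}.

Record ideal (M : wmonoid) := Ideal {
  ideal_set :> M -> Prop;
  idealP : is_ideal ideal_set
}.

Section IdealOrder.
Context (M : wmonoid).
Implicit Types I J : ideal M.

Lemma ideal_eq I J : (forall a, I a <-> J a) -> I = J.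
Proof.
case: I J => [I pI] [J pJ] /= IJ.
have eIJ : I = J by apply/funext => a; apply/propext.
by move: pI; rewrite eIJ => pI; congr Ideal; exact: Prop_irrelevance.
Qed.

HB.instance Definition _ := gen_eqMixin (ideal M).
HB.instance Definition _ := gen_choiceMixin (ideal M).

Definition ideal_le I J : bool := `[< forall a, I a -> J a >].

Fact ideal_le_refl : reflexive ideal_le.
Proof. by move=> I; apply/asboolP. Qed.

Fact ideal_le_anti : antisymmetric ideal_le.
Proof.
move=> I J /andP[/asboolP IJ /asboolP JI]; apply: ideal_eq => a.
by split; [exact: IJ|exact: JI].
Qed.

Fact ideal_le_trans : transitive ideal_le.
Proof.
by move=> J I K /asboolP IJ /asboolP JK; apply/asboolP => a /IJ/JK.
Qed.

HB.instance Definition _ := Order.Le_isPOrder.Build pom_display (ideal M)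
  ideal_le_refl ideal_le_anti ideal_le_trans.

Lemma ideal_leP I J : reflect (forall a, I a -> J a) (I <= J).
Proof. exact: asboolP. Qed.

Lemma ideal_sub I J a : I <= J -> I a -> J a.
Proof. by move=> /ideal_leP; apply. Qed.

Lemma ideal_prec I a b : a ≺ b -> I b -> I a.
Proof. exact: (ideal_down (idealP I)). Qed.

Lemma ideal_round I a : I a -> exists2 b, I b & a ≺ b.
Proof. by move=> Ia; have [c [Ic ac _]] := ideal_dir (idealP I) Ia Ia; exists c. Qed.

(** Directedness is applied alternately to the last element of the chain
    and the next generator. *)
Lemma ideal_chain I : exists v : nat -> M,
  [/\ forall n, I (v n), forall n, v n ≺ v n.+1 &
      forall a, I a -> exists n, a ≺ v n].
Proof.
have [g [Ig gcof]] := ideal_gen (idealP I).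
have /choice[F FP] : forall ab : M * M, exists c,
    I ab.1 -> I ab.2 -> [/\ I c, ab.1 ≺ c & ab.2 ≺ c].
  move=> [a b] /=; have [Ia|nIa] := pselect (I a); last by exists a.
  have [Ib|nIb] := pselect (I b); last by exists a.
  by have [c ?] := ideal_dir (idealP I) Ia Ib; exists c.
pose v := fix v n := if n is m.+1 then F (v m, g m) else g 0%N.
have Iv n : I (v n).
  by elim: n => [|n IHn] //=; have [] := FP (v n, g n) IHn (Ig n).
have vstep n : v n ≺ v n.+1 /\ g n ≺ v n.+1.
  by have [] := FP (v n, g n) (Iv n) (Ig n).
exists v; split=> // [n|a /gcof[n an]]; first by have [] := vstep n.
by exists n.+1; apply: wm_trans an _; have [] := vstep n.
Qed.

Lemma prec_homo (v : nat -> M) : (forall n, v n ≺ v n.+1) ->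
  {homo v : m n / (m < n)%N >-> m ≺ n}.
Proof. by apply: homo_ltn => b a c; exact: wm_trans. Qed.

Lemma prec_maxn (v : nat -> M) a m n : (forall n, v n ≺ v n.+1) ->
  a ≺ v m \/ a ≺ v n -> a ≺ v (maxn m n).+1.
Proof.
move=> /prec_homo vmono [] /wm_trans; apply; apply: vmono; rewrite ltnS.
  exact: leq_maxl.
exact: leq_maxr.
Qed.

Fact is_ideal_principal (p : M) : is_ideal (fun a : M => a ≺ p).
Proof.
have [u [ustep up ucof]] := wm_chain p.
split; [exact: wm_prec0|by move=> a b; exact: wm_trans| |by exists u].
move=> a b /ucof[m am] /ucof[n bn]; exists (u (maxn m n).+1).
by split=> //; apply: prec_maxn => //; [left|right].
Qed.

Definition principal (p : M) : ideal M := Ideal (is_ideal_principal p).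

Lemma principal_le p I : I p -> principal p <= I.
Proof. by move=> Ip; apply/ideal_leP => a ap; apply: ideal_prec ap Ip. Qed.

Lemma principal_sup I (v : nat -> M) : (forall n, I (v n)) ->
    (forall a, I a -> exists n, a ≺ v n) ->
  is_seq_sup (fun n => principal (v n)) I.
Proof.
move=> Iv vcof; apply/seq_supP; split=> [n|J vJ]; first exact: principal_le.
by apply/ideal_leP => a /vcof[n]; exact: ideal_sub (vJ n).
Qed.

Lemma principal_increasing (v : nat -> M) : (forall n, v n ≺ v n.+1) ->
  increasing (fun n => principal (v n)).
Proof. by move=> vstep; apply: increasing_step => n; exact/principal_le/vstep. Qed.

Fact is_ideal_bigcup (z : nat -> ideal M) : increasing z ->
  is_ideal (fun a => exists n, z n a).
Proof.
move=> zinc; split; first by exists 0%N; exact: ideal0 (idealP _).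
- by move=> a b ab [n zb]; exists n; exact: ideal_prec ab zb.
- move=> a b [m za] [n zb].
  have za' := ideal_sub (zinc _ _ (leq_maxl m n)) za.
  have zb' := ideal_sub (zinc _ _ (leq_maxr m n)) zb.
  have [c [zc ac bc]] := ideal_dir (idealP _) za' zb'.
  by exists c; split=> //; exists (maxn m n).
have /choice[g gP] n := ideal_gen (idealP (z n)).
(* A doubly indexed family of generators, enumerated through pairs of naturals;
   codes of no pair are sent to an arbitrary generator. *)
pose h k := if @unpickle (nat * nat)%type k is Some mn then g mn.1 mn.2
            else g 0%N 0%N.
exists h; split=> [k|a [m zma]].
  rewrite /h; case: unpickle => [[m n]|] /=.
    by exists m; have [] := gP m.
  by exists 0%N; have [] := gP 0%N.
have [_ /(_ a zma)[n an]] := gP m.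
by exists (pickle (m, n)); rewrite /h pickleK.
Qed.

Definition ideal_bigcup z (zinc : increasing z) : ideal M :=
  Ideal (is_ideal_bigcup zinc).

Lemma ideal_bigcup_sup z (zinc : increasing z) :
  is_seq_sup z (ideal_bigcup zinc).
Proof.
apply/seq_supP; split=> [n|J zJ]; apply/ideal_leP => a; first by exists n.
by move=> [n]; exact: ideal_sub (zJ n).
Qed.

Lemma ideal_supE z I a : increasing z -> is_seq_sup z I ->
  I a <-> exists n, z n a.
Proof.
by move=> zinc zI; rewrite (isLub_unique zI (ideal_bigcup_sup zinc)).
Qed.

(** An ideal is the supremum of the principal ideals of a generating chain, so
    anything way below it is caught by one of them; conversely an element
    of a union lies in one of its members. *)
Lemma ideal_way_belowP I J : I ≪ J <-> exists2 a, J a & I <= principal a.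
Proof.
split=> [IJ|[a Ja Ia] z s zinc zs /ideal_leP/(_ _ Ja)].
  have [v [Jv vstep vcof]] := ideal_chain J.
  have [//|m Im] := IJ _ _ (principal_increasing vstep) (principal_sup Jv vcof).
  by exists (v m).
move=> /(ideal_supE _ zinc zs)[m zma].
by exists m; apply: le_trans Ia (principal_le zma).
Qed.

(** By roundness, a sum [a + b] lies [≺]-below a sum of larger elements of [I] and [J];
    this slack is what makes the set of all [p ≺ a + b] directed. *)
Fact is_ideal_add I J :
  is_ideal (fun p => exists a b, [/\ I a, J b & p ≺ wm_add a b]).
Proof.
split.
- exists (wm_zero M), (wm_zero M).
  by split; [exact: ideal0 (idealP I)|exact: ideal0 (idealP J)|exact: wm_prec0].
- move=> p q pq [a [b [Ia Jb qab]]]; exists a, b; split=> //.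
  exact: wm_trans qab.
- move=> p q [a [b [Ia Jb pab]]] [a' [b' [Ia' Jb' qab]]].
  have [c [Ic ac a'c]] := ideal_dir (idealP I) Ia Ia'.
  have [e [Je be b'e]] := ideal_dir (idealP J) Jb Jb'.
  have [c' Ic' cc'] := ideal_round Ic.
  have [e' Je' ee'] := ideal_round Je.
  exists (wm_add c e); split.
  + by exists c', e'; split=> //; exact: wm_precD.
  + by apply: wm_trans pab _; exact: wm_precD.
  + by apply: wm_trans qab _; exact: wm_precD.
have [v [Iv vstep vcof]] := ideal_chain I.
have [w [Jw wstep wcof]] := ideal_chain J.
exists (fun n => wm_add (v n) (w n)); split=> [n|p [a [b [Ia Jb pab]]]].
  by exists (v n.+1), (w n.+1); split=> //; exact: wm_precD.
have [m am] := vcof _ Ia; have [n bn] := wcof _ Jb.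
exists (maxn m n).+1; apply: wm_trans pab _; apply: wm_precD.
  by apply: prec_maxn => //; left.
by apply: prec_maxn => //; right.
Qed.

Definition ideal_add I J : ideal M := Ideal (is_ideal_add I J).

Fact ideal_addC : commutative ideal_add.
Proof.
by move=> I J; apply: ideal_eq => p; split=> -[a [b [? ? /wm_addC]]];
  exists b, a.
Qed.

Fact ideal_addA : associative ideal_add.
Proof.
move=> I J K; apply: ideal_eq => p; split.
  move=> [a [q [Ia [b [c [Jb Kc qbc]]] paq]]].
  have [a' Ia' aa'] := ideal_round Ia; have [b' Jb' bb'] := ideal_round Jb.
  exists (wm_add a' b), c; split=> //.
    have [a'' Ia'' a'a''] := ideal_round Ia'.
    by exists a'', b'; split=> //; exact: wm_precD.
  by apply/wm_addA; apply: wm_trans paq _; exact: wm_precD.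
move=> [q [c [[a [b [Ia Jb qab]]] Kc pqc]]].
have [c' Kc' cc'] := ideal_round Kc; have [b' Jb' bb'] := ideal_round Jb.
exists a, (wm_add b c'); split=> //.
  have [c'' Kc'' c'c''] := ideal_round Kc'.
  by exists b', c''; split=> //; exact: wm_precD.
by apply/wm_addA; apply: wm_trans pqc _; exact: wm_precD.
Qed.

Fact ideal_add0 : left_id (principal (wm_zero M)) ideal_add.
Proof.
move=> I; apply: ideal_eq => p; split=> [[z [a [z0 Ia pza]]]|Ip].
  have [a' Ia' aa'] := ideal_round Ia.
  apply: (ideal_prec _ Ia'); apply/wm_add0.
  by apply: wm_trans pza _; exact: wm_precD.
have [a Ia pa] := ideal_round Ip.
exists (wm_zero M), a; split=> //; first exact: wm_prec0.
exact/wm_add0.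
Qed.

Fact ideal_ge0 I : principal (wm_zero M) <= I.
Proof. exact/principal_le/(ideal0 (idealP I)). Qed.

Fact ideal_leD2r K I J : I <= J -> ideal_add I K <= ideal_add J K.
Proof.
move=> /ideal_leP IJ; apply/ideal_leP => p [a [b [Ia Kb pab]]].
by exists a, b; split=> //; exact: IJ.
Qed.

HB.instance Definition _ := isPositivelyOrderedMonoid.Build (ideal M)
  ideal_addA ideal_addC ideal_add0 ideal_ge0 ideal_leD2r.

Fact ideal_O1 (u : nat -> ideal M) : increasing u -> exists s, is_seq_sup u s.
Proof. by move=> uinc; exists (ideal_bigcup uinc); exact: ideal_bigcup_sup. Qed.

Lemma principal_way_below p I : I p -> principal p ≪ I.
Proof. by move=> Ip; apply/ideal_way_belowP; exists p. Qed.

Fact ideal_O2 I : exists u : nat -> ideal M,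
  (forall n, u n ≪ u n.+1) /\ is_seq_sup u I.
Proof.
have [v [Iv vstep vcof]] := ideal_chain I.
exists (fun n => principal (v n)); split=> [n|]; last exact: principal_sup.
exact/principal_way_below/vstep.
Qed.

Fact ideal_O3 I' I J' J : I' ≪ I -> J' ≪ J -> I' + J' ≪ I + J.
Proof.
move=> /ideal_way_belowP[a Ia /ideal_leP I'a].
move=> /ideal_way_belowP[b Jb /ideal_leP J'b].
apply/ideal_way_belowP; exists (wm_add a b).
  have [a' Ia' aa'] := ideal_round Ia; have [b' Jb' bb'] := ideal_round Jb.
  by exists a', b'; split=> //; exact: wm_precD.
apply/ideal_leP => p [a' [b' [/I'a a'a /J'b b'b pab]]].
by apply: wm_trans pab _; exact: wm_precD.
Qed.

Fact ideal_O4 (u v : nat -> ideal M) I J : increasing u -> increasing v ->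
  is_seq_sup u I -> is_seq_sup v J -> is_seq_sup (fun n => u n + v n) (I + J).
Proof.
move=> uinc vinc uI vJ.
have /seq_supP[uleI _] := uI; have /seq_supP[vleJ _] := vJ.
apply/seq_supP; split=> [n|K uvK].
  apply/ideal_leP => p [a [b [ua vb pab]]]; exists a, b; split=> //.
    exact: ideal_sub (uleI n) ua.
  exact: ideal_sub (vleJ n) vb.
apply/ideal_leP => p [a [b []]].
move=> /(ideal_supE _ uinc uI)[m uma] /(ideal_supE _ vinc vJ)[n vnb] pab.
apply: ideal_sub (uvK (maxn m n)) _; exists a, b; split=> //.
  exact: ideal_sub (uinc _ _ (leq_maxl m n)) uma.
exact: ideal_sub (vinc _ _ (leq_maxr m n)) vnb.
Qed.

HB.instance Definition _ := isCuSemigroup.Build (ideal M)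
  ideal_O1 ideal_O2 ideal_O3 ideal_O4.

(** The one place where the splitting axiom enters: it makes the canonical map
    to the completion additive. *)
Lemma principalD a b :
  principal (wm_add a b) = principal a + principal b :> ideal M.
Proof.
apply: ideal_eq => p; split=> [/wm_split[a' [b' [? ? ?]]]|]; first by exists a', b'.
by move=> [a' [b' [aa' bb' pab]]]; apply: wm_trans pab _; exact: wm_precD.
Qed.

End IdealOrder.

(** * Extension of maps to the completion *)

(** The last condition replaces preservation of suprema: it says that [f b] is the
    supremum of the [f a] with [a ≺ b]. *)
Record w_morphism (M : wmonoid) (T : cuType) (f : M -> T) : Prop := WMorphism {
  w_mor0 : f (wm_zero M) = 0;
  w_morD : forall a b, f (wm_add a b) = f a + f b;
  w_mor_prec : forall a b, a ≺ b -> f a ≪ f b;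
  w_mor_cont : forall y b, y ≪ f b -> exists2 a, a ≺ b & y <= f a
}.

Section Extension.
Context (M : wmonoid) (T : cuType) (f : M -> T) (fP : w_morphism f).
Implicit Types I J : ideal M.

Let f_le a b : a ≺ b -> f a <= f b.
Proof. by move=> /(w_mor_prec fP)/way_below_le. Qed.

Lemma image_chain_increasing (v : nat -> M) : (forall n, v n ≺ v n.+1) ->
  increasing (f \o v).
Proof. by move=> vstep; apply: increasing_step => n; exact: f_le. Qed.

(** Turns the supremum over an ideal, which does not depend on choices, into a
    supremum of a sequence, to which (O1) and (O4) apply. *)
Lemma image_chain_sup I (v : nat -> M) s : (forall n, I (v n)) ->
    (forall a, I a -> exists n, a ≺ v n) ->
  is_seq_sup (f \o v) s <-> isLub (f @` I) s.
Proof.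
move=> Iv vcof.
have ubE t : (forall n, f (v n) <= t) <-> ubound (f @` I) t.
  split=> [vt _ [a Ia <-]|It n]; last by apply: It; exists (v n).
  by have [n /f_le avn] := vcof _ Ia; exact: le_trans avn (vt n).
by rewrite seq_supP; split=> -[/ubE ubs ls]; split=> // t /ubE; exact: ls.
Qed.

Lemma ideal_image_lub I : exists s, isLub (f @` I) s.
Proof.
have [v [Iv vstep vcof]] := ideal_chain I.
have [s vs] := cuO1 _ (image_chain_increasing vstep).
by exists s; apply/(image_chain_sup _ Iv vcof).
Qed.

Definition extend I : T := sval (cid (ideal_image_lub I)).

Lemma extendP I : isLub (f @` I) (extend I).
Proof. by rewrite /extend; case: cid. Qed.

Lemma extend_ub I a : I a -> f a <= extend I.
Proof. by move=> Ia; have [+ _] := extendP I; apply; exists a. Qed.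

Lemma extend_least I t : (forall a, I a -> f a <= t) -> extend I <= t.
Proof. by move=> It; have [_] := extendP I; apply=> _ [a Ia <-]; exact: It. Qed.

Lemma extend_le I J : I <= J -> extend I <= extend J.
Proof.
by move=> /ideal_leP IJ; apply: extend_least => a /IJ; exact: extend_ub.
Qed.

Lemma extend_principal p : extend (principal p) = f p.
Proof.
apply/le_anti/andP; split; first by apply: extend_least => a; exact: f_le.
have [u [_ _ ufp /seq_supP[_]]] := way_below_chain (f p); apply=> n.
have [a ap una] := w_mor_cont fP (ufp n).
by apply: le_trans una _; exact: extend_ub.
Qed.

Lemma extend_cu : cu_morphism extend.
Proof.
split.
- by rewrite extend_principal (w_mor0 fP).
- move=> I J.
  have [v [Iv vstep vcof]] := ideal_chain I.
  have [w [Jw wstep wcof]] := ideal_chain J.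
  have /seq_supP[_ lst] := cuO4 _ _ _ _ (image_chain_increasing vstep)
    (image_chain_increasing wstep)
    (proj2 (image_chain_sup _ Iv vcof) (extendP I))
    (proj2 (image_chain_sup _ Jw wcof) (extendP J)).
  apply/le_anti/andP; split.
    apply: extend_least => p [a [b [Ia Jb /f_le pab]]].
    by apply: le_trans pab _; rewrite (w_morD fP);
      apply: pom_leD; exact: extend_ub.
  apply: lst => n /=; rewrite -(w_morD fP); apply: extend_ub.
  by exists (v n.+1), (w n.+1); split=> //; exact: wm_precD.
- exact: extend_le.
- move=> I J /ideal_way_belowP[a Ja Ia].
  have [b Jb ab] := ideal_round Ja.
  apply: (@le_way_below_trans _ _ _ (f a)).
    by rewrite -extend_principal; exact: extend_le.
  exact: way_below_le_trans (w_mor_prec fP ab) (extend_ub Jb).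
move=> u I uinc uI; have /seq_supP[uleI _] := uI.
apply/seq_supP; split=> [n|t ut]; first exact: extend_le.
apply: extend_least => a /(ideal_supE _ uinc uI)[n una].
by apply: le_trans (ut n); exact: extend_ub.
Qed.

(** Every ideal is the supremum of an increasing sequence of principal ideals, where
    the values are prescribed. *)
Lemma extend_unique (g : ideal M -> T) : cu_morphism g ->
  (forall p, g (principal p) = f p) -> g =1 extend.
Proof.
move=> gP gf I; have [v [Iv vstep vcof]] := ideal_chain I.
have := cu_mor_sup gP (principal_increasing vstep) (principal_sup Iv vcof).
rewrite (_ : (fun n => _) = f \o v); last by apply/funext => n; exact: gf.
by move=> /(image_chain_sup _ Iv vcof)/isLub_unique; apply; exact: extendP.
Qed.

End Extension.

(** * Weakly increasing sequences and generated submonoids *)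

Section Generated.
Context (S : cuType).

Record scu_closed (V : set S) : Prop := ScuClosed {
  scu_closed0 : V 0;
  scu_closedD : forall x y, V x -> V y -> V (x + y);
  scu_closed_sup : forall (x : nat -> S) s, (forall n, V (x n)) ->
    weakly_increasing x -> is_seq_sup x s -> V s
}.

(** Defined as an intersection, so that maps out of the limit respect the submonoid
    as soon as they do so on [A]. *)
Definition scu_gen (A : set S) : set S :=
  fun x => forall V, scu_closed V -> A `<=` V -> V x.

Lemma scu_gen_closed (A : set S) : scu_closed (scu_gen A).
Proof.
split=> [V VP _|x y Ax Ay V VP AV|x s Ax winc xs V VP AV].
- exact: scu_closed0 VP.
- by apply: (scu_closedD VP); [exact: Ax|exact: Ay].
- by apply: (scu_closed_sup VP _ winc xs) => n; exact: Ax.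
Qed.

Lemma sub_scu_gen (A : set S) : A `<=` scu_gen A.
Proof. by move=> x Ax V _; apply. Qed.

Definition scu_generated (A : set S) : scuType :=
  SCu (scu_closed0 (scu_gen_closed A)) (scu_closedD (scu_gen_closed A))
      (scu_closed_sup (scu_gen_closed A)).

(** Reduces suprema of weakly increasing sequences to those of increasing ones, the
    only suprema that Cu-morphisms preserve by definition. *)
Lemma weakly_increasing_sup (x y : nat -> S) s :
    (forall m, exists n0, forall n, (n0 <= n)%N -> y m <= x n) ->
    (forall t, is_seq_sup y t -> forall n, x n <= t) -> increasing y ->
  is_seq_sup x s <-> is_seq_sup y s.
Proof.
move=> yx xy yinc; have [t yt] := cuO1 _ yinc.
suff xt : is_seq_sup x t.
  by split=> [/isLub_unique/(_ xt)->|/isLub_unique/(_ yt)->].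
have /seq_supP[_ lst] := yt.
apply/seq_supP; split=> [|r xr]; first exact: xy.
apply: lst => m; have [n0 /(_ n0 (leqnn _)) ymx] := yx m.
exact: le_trans ymx (xr n0).
Qed.

End Generated.

Section GeneratedMap.
Context (S T : cuType) (f : S -> T) (fP : cu_morphism f).

Lemma cu_mor_weakly_increasing (x : nat -> S) s :
    weakly_increasing x -> is_seq_sup x s ->
  weakly_increasing (f \o x) /\ is_seq_sup (f \o x) (f s).
Proof.
move=> [y [yinc yx xy]] /(weakly_increasing_sup _ yx xy yinc) ys.
have fyinc : increasing (f \o y).
  by move=> m n /yinc; exact: cu_mor_le fP _ _.
have fys : is_seq_sup (f \o y) (f s) := cu_mor_sup fP yinc ys.
have fyx m : exists n0, forall n, (n0 <= n)%N -> (f \o y) m <= (f \o x) n.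
  by have [n0 yxn] := yx m; exists n0 => n /yxn; exact: cu_mor_le fP _ _.
have fxy t : is_seq_sup (f \o y) t -> forall n, (f \o x) n <= t.
  by move=> /isLub_unique/(_ fys)-> n; apply: cu_mor_le fP _ _ _; exact: xy.
split; last by apply/(weakly_increasing_sup _ fyx fxy fyinc).
by exists (f \o y).
Qed.

Lemma scu_closed_preimage (V : set T) : scu_closed V -> scu_closed (f @^-1` V).
Proof.
move=> VP; split=> [|x y Vx Vy|x s Vx winc xs]; rewrite /preimage/=.
- by rewrite (cu_mor0 fP); exact: scu_closed0.
- by rewrite (cu_morD fP); exact: scu_closedD.
- have [fwinc fxs] := cu_mor_weakly_increasing winc xs.
  exact: scu_closed_sup VP _ _ Vx fwinc fxs.
Qed.

End GeneratedMap.

Lemma scu_sub_closed (S : scuType) : scu_closed (@scu_sub S).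
Proof. by split; [exact: scu_sub0|exact: scu_subD|exact: scu_sub_sup]. Qed.

(** * The direct limit *)

Section Limit.
Context d (Omega : preorderType d) (dirOmega : directed Omega).
Context (D : scuSystem Omega).

(** A statement about late indices only; directedness makes these closed under
    conjunction, which absorbs all choices of common upper bounds. *)
Definition eventually (P : Omega -> Prop) :=
  exists k0, forall k, k0 <= k -> P k.

Lemma eventually_ge l : eventually (fun k => l <= k).
Proof. by exists l. Qed.

Lemma eventually_all (P : Omega -> Prop) : (forall k, P k) -> eventually P.
Proof. by move=> PP; have [[k _] _] := dirOmega; exists k. Qed.

Lemma eventually_and P Q :
  eventually P -> eventually Q -> eventually (fun k => P k /\ Q k).
Proof.
move=> [k1 P1] [k2 Q2]; have [k [k1k k2k]] := dirOmega.2 k1 k2.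
exists k => j kj; split; [apply: P1|apply: Q2]; exact: le_trans kj.
Qed.

Lemma eventually_imp (P Q : Omega -> Prop) : (forall k, P k -> Q k) ->
  eventually P -> eventually Q.
Proof. by move=> PQ [k0 Pk0]; exists k0 => k /Pk0/PQ. Qed.

Lemma eventually_ex P : eventually P -> exists k, P k.
Proof. by move=> [k Pk]; exists k; exact: Pk. Qed.

(** A pair stands for the class of its component in the algebraic limit. *)
Definition elt := {l : Omega & D l}.
Implicit Types (p q a b : elt) (l m k : Omega).

Definition mk l (x : D l) : elt := existT _ l x.

(** The image of [p] at index [k]. The value [0] at indices [k] that are not above
    the index of [p] is a convention that makes [ev] total, so that no proof of
    comparison is carried around; it is invisible to eventual statements. *)
Definition ev k p : D k :=
  if (tag p <= k) =P true is ReflectT h then sys_map D h (tagged p) else 0.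

Lemma evE l k (lk : l <= k) (x : D l) : ev k (mk x) = sys_map D lk x.
Proof.
rewrite /ev /=; case: eqP => [h|]; last by rewrite lk.
by rewrite (bool_irrelevance h lk).
Qed.

Lemma ev_map p k k' (kk' : k <= k') : tag p <= k ->
  sys_map D kk' (ev k p) = ev k' p.
Proof.
case: p => l x /= lk; rewrite !evE; first exact: le_trans kk'.
by move=> lk'; rewrite -(sys_map_comp lk kk' lk').
Qed.


Definition prec p q := eventually (fun k => ev k p ≪ ev k q).

(** Connecting maps preserve [≪], so one late index suffices. *)
Lemma prec_at k p q : tag p <= k -> tag q <= k -> ev k p ≪ ev k q -> prec p q.
Proof.
move=> pk qk pq; exists k => j kj; rewrite -(ev_map kj pk) -(ev_map kj qk).
exact: cu_mor_way_below (scu_fun_cu _) _ _ pq.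
Qed.

Lemma prec_ex p q : prec p q ->
  exists k, [/\ tag p <= k, tag q <= k & ev k p ≪ ev k q].
Proof.
move=> pq; have := eventually_and (eventually_and (eventually_ge (tag p))
  (eventually_ge (tag q))) pq.
by move=> /eventually_ex[k [[? ?] ?]]; exists k.
Qed.

Lemma prec_mk l (x y : D l) : x ≪ y -> prec (mk x) (mk y).
Proof.
move=> xy; exists l => k lk; rewrite !evE.
exact: cu_mor_way_below (scu_fun_cu _) _ _ xy.
Qed.

Lemma eq_prec p q q' : eventually (fun k => ev k q = ev k q') ->
  prec p q -> prec p q'.
Proof. by move=> qq' /(eventually_and qq'); apply: eventually_imp => k [->]. Qed.

Lemma eventually_sym p q : eventually (fun k => ev k p = ev k q) ->
  eventually (fun k => ev k q = ev k p).
Proof. exact: eventually_imp. Qed.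

Definition base : Omega := sval (cid dirOmega.1).

Definition zero : elt := mk (0 : D base).

Lemma ev0 k : ev k zero = 0.
Proof.
rewrite /ev; case: eqP => // h; exact: cu_mor0 (scu_fun_cu _).
Qed.

Definition join l m : Omega := sval (cid (dirOmega.2 l m)).

Lemma joinP l m : l <= join l m /\ m <= join l m.
Proof. by rewrite /join; case: cid. Qed.

Definition add p q : elt :=
  mk (ev (join (tag p) (tag q)) p + ev (join (tag p) (tag q)) q).

Lemma evD p q : eventually (fun k => ev k (add p q) = ev k p + ev k q).
Proof.
exists (join (tag p) (tag q)) => k jk; rewrite evE (cu_morD (scu_fun_cu _)).
by have [pj qj] := joinP (tag p) (tag q); rewrite !ev_map.
Qed.

Lemma prec_trans p q r : prec p q -> prec q r -> prec p r.
Proof.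
move=> pq /(eventually_and pq); apply: eventually_imp => k [].
exact: way_below_trans.
Qed.

Lemma prec0 p : prec zero p.
Proof. by apply: eventually_all => k; rewrite ev0; exact: way_below0. Qed.

(** Suprema formed inside one object stay suprema in the limit: interpolating
    between [p] and [x] at a late index leaves room to apply the definition
    of [≪] there. *)
Lemma prec_sup l (u : nat -> D l) (x : D l) p : increasing u ->
  is_seq_sup u x -> prec p (mk x) -> exists n, prec p (mk (u n)).
Proof.
move=> uinc ux /prec_ex[k [pk lk]]; rewrite evE.
move=> /way_below_interpolate[z pz zx].
have /zx := cu_mor_sup (scu_fun_cu (sys_map D lk)) uinc ux.
case=> // [m n mn|n zn]; first exact: cu_mor_le (scu_fun_cu _) _ _ (uinc _ _ mn).
exists n; apply: (@prec_at k) => //; rewrite evE.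
exact: way_below_le_trans zn.
Qed.

Lemma prec_chain p : exists u : nat -> elt,
  [/\ forall n, prec (u n) (u n.+1), forall n, prec (u n) p &
      forall q, prec q p -> exists n, prec q (u n)].
Proof.
case: p => l x; have [u [ustep uinc ux usup]] := way_below_chain x.
exists (fun n => mk (u n)); split=> [n|n|q]; [exact: prec_mk..|].
exact: prec_sup.
Qed.

Lemma precD p p' q q' : prec p p' -> prec q q' -> prec (add p q) (add p' q').
Proof.
move=> pp' qq'.
have := eventually_and (eventually_and pp' qq')
  (eventually_and (evD p q) (evD p' q')).
by apply: eventually_imp => k [[? ?] [-> ->]]; exact: cuO3.
Qed.

(** At a late index, (O4) presents the sum as the supremum of the sums of two
    approximating chains. Stepping one term further, from [n] to [n.+1], turns
    the resulting inequality into [≪] by (O3). *)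
Lemma prec_split p q r : prec p (add q r) ->
  exists q' r', [/\ prec q' q, prec r' r & prec p (add q' r')].
Proof.
move=> pqr.
have [k [[pk [qk rk]] [+ qrk]]] := eventually_ex (eventually_and
  (eventually_and (eventually_ge (tag p))
    (eventually_and (eventually_ge (tag q)) (eventually_ge (tag r))))
  (eventually_and pqr (evD q r))).
rewrite qrk => pk_qr.
have [u [ustep uinc uq usup]] := way_below_chain (ev k q).
have [v [vstep vinc vr vsup]] := way_below_chain (ev k r).
have uvinc : increasing (fun n => u n + v n).
  by move=> m n mn; apply: pom_leD; [exact: uinc|exact: vinc].
have [//|n pn] := pk_qr _ _ uvinc (cuO4 _ _ _ _ uinc vinc usup vsup).
have ev_mk (x : D k) : ev k (mk x) = x by rewrite evE sys_map_id.
exists (mk (u n.+1)), (mk (v n.+1)).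
split; [by apply: (@prec_at k) => //; rewrite ev_mk..|].
suff: prec p (mk (u n.+1 + v n.+1)).
  apply: eq_prec; have := evD (mk (u n.+1)) (mk (v n.+1)).
  move=> /(eventually_and (eventually_ge k)); apply: eventually_imp => j [kj ->].
  by rewrite !evE (cu_morD (scu_fun_cu _)).
apply: (@prec_at k) => //; rewrite ev_mk.
exact: le_way_below_trans pn (cuO3 _ _ _ _ (ustep n) (vstep n)).
Qed.

Lemma prec_addC p q r : prec p (add q r) -> prec p (add r q).
Proof.
apply: eq_prec; have := eventually_and (evD q r) (evD r q).
by apply: eventually_imp => k [-> ->]; rewrite pom_addC.
Qed.

Lemma prec_addA p q r s :
  prec p (add q (add r s)) <-> prec p (add (add q r) s).
Proof.
have qrs : eventually
    (fun k => ev k (add q (add r s)) = ev k (add (add q r) s)).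
  have := eventually_and (eventually_and (evD q (add r s)) (evD r s))
    (eventually_and (evD (add q r) s) (evD q r)).
  by apply: eventually_imp => k [[-> ->] [-> ->]]; rewrite pom_addA.
by split; apply: eq_prec => //; exact: eventually_sym.
Qed.

Lemma prec_add0 p q : prec p (add zero q) <-> prec p q.
Proof.
have q0 : eventually (fun k => ev k (add zero q) = ev k q).
  by apply: eventually_imp (evD zero q) => k ->; rewrite ev0 pom_add0.
by split; apply: eq_prec => //; exact: eventually_sym.
Qed.

Definition elt_wmonoid : wmonoid := WMonoid prec_trans prec0 prec_chain precD
  prec_split prec_addC prec_addA prec_add0.

Lemma principal_ev p q : eventually (fun k => ev k p = ev k q) ->
  principal (p : elt_wmonoid) = principal (q : elt_wmonoid).
Proof.
move=> pq; apply: ideal_eq => r.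
by split; apply: eq_prec => //; exact: eventually_sym.
Qed.

Definition leg l (x : D l) : ideal elt_wmonoid := principal (mk x : elt_wmonoid).

Lemma leg_cu l : cu_morphism (@leg l).
Proof.
have leg_le (x y : D l) : x <= y -> leg x <= leg y.
  move=> xy; apply/ideal_leP => p /(eventually_and (eventually_ge l)).
  apply: eventually_imp => k [lk] /way_below_le_trans; apply.
  by rewrite !evE; exact: cu_mor_le (scu_fun_cu _) _ _ xy.
split=> //.
- apply: principal_ev; exists l => k lk.
  by rewrite ev0 evE (cu_mor0 (scu_fun_cu _)).
- move=> x y; rewrite -principalD; apply: principal_ev.
  have := evD (mk x) (mk y).
  move=> /(eventually_and (eventually_ge l)); apply: eventually_imp => j [kj ->].
  by rewrite !evE (cu_morD (scu_fun_cu _)).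
- by move=> x y xy; apply: principal_way_below; exact: prec_mk.
move=> u x uinc ux; have /seq_supP[ule _] := ux.
apply/seq_supP; split=> [n|I uI]; first exact: leg_le.
by apply/ideal_leP => p /(prec_sup uinc ux)[n]; exact: ideal_sub (uI n).
Qed.

Lemma leg_comm l m (lm : l <= m) (x : D l) : leg (sys_map D lm x) = leg x.
Proof.
apply: principal_ev; exists m => k mk'; rewrite !evE.
  exact: le_trans mk'.
by move=> lk; rewrite -(sys_map_comp lm mk' lk).
Qed.

Definition leg_images : set (ideal elt_wmonoid) :=
  fun I => exists l (x : D l), scu_sub x /\ I = leg x.

Definition limit_obj : scuType := scu_generated leg_images.

Lemma leg_sub l (x : D l) : scu_sub x -> @scu_sub limit_obj (leg x).
Proof. by move=> Wx; apply: sub_scu_gen; exists l, x. Qed.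

Definition limit_leg l : scuHom (D l) limit_obj :=
  @SCuHom (D l) limit_obj (@leg l) (leg_cu l) (@leg_sub l).

Definition limit_cocone : scuCocone D := @SCuCocone _ _ D limit_obj limit_leg
  (fun l m lm x => leg_comm lm x).

Section Universal.
Context (C : scuCocone D).

Definition glue p : C := cocone_leg C (tag p) (tagged p).

Lemma glue_ev k p : tag p <= k -> glue p = cocone_leg C k (ev k p).
Proof. by case: p => l x /= lk; rewrite evE; exact/esym/(cocone_comm C lk). Qed.

Lemma glue_w_morphism : @w_morphism elt_wmonoid C glue.
Proof.
split.
- exact: cu_mor0 (scu_fun_cu _).
- move=> p q; have [pj qj] := joinP (tag p) (tag q).
  by rewrite /= (glue_ev pj) (glue_ev qj) -(cu_morD (scu_fun_cu _)).
- move=> p q /prec_ex[k [pk qk pq]]; rewrite (glue_ev pk) (glue_ev qk).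
  exact: cu_mor_way_below (scu_fun_cu _) _ _ pq.
move=> y [l x] yx; have [u [ustep uinc ux usup]] := way_below_chain x.
have /yx := cu_mor_sup (scu_fun_cu (cocone_leg C l)) uinc usup.
case=> // [m n mn|n yn]; first exact: cu_mor_le (scu_fun_cu _) _ _ (uinc _ _ mn).
by exists (mk (u n)) => //; exact: prec_mk.
Qed.

Definition desc : ideal elt_wmonoid -> C := extend glue_w_morphism.

Lemma desc_leg l (x : D l) : desc (leg x) = cocone_leg C l x.
Proof. exact: extend_principal. Qed.

Lemma desc_sub (I : limit_obj) : scu_sub I -> scu_sub (desc I).
Proof.
move=> WI; apply: (WI (desc @^-1` @scu_sub C)).
  exact: (scu_closed_preimage (extend_cu glue_w_morphism) (@scu_sub_closed C)).
move=> _ [l [x [Wx ->]]]; rewrite /preimage /= desc_leg.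
exact: scu_fun_sub.
Qed.

Definition limit_desc : scuHom limit_obj C :=
  @SCuHom limit_obj C desc (extend_cu _) desc_sub.

End Universal.

Lemma limit_cocone_universal : is_direct_limit limit_cocone.
Proof.
move=> C; exists (limit_desc C) => [l x|g gleg I]; first exact: desc_leg.
apply: extend_unique (scu_fun_cu g) _ _ => -[l x]; exact: gleg.
Qed.

End Limit.

Theorem theorem9p1 (d : Order.disp_t) (Omega : preorderType d)
    (dirOmega : directed Omega) (D : scuSystem Omega) :
  exists L : scuCocone D, is_direct_limit L.
Proof. by exists (limit_cocone dirOmega D); exact: limit_cocone_universal. Qed.
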